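(* Let $\alpha>0$. The equilateral triangle with equal masses is the unique centered co-circular central configuration for the $3$-body problem with power-law potential $U_\alpha$. That is: let $m_1,m_2,m_3>0$ and let $x_1,x_2,x_3$ be pairwise distinct points lying on a common circle whose center is the center of mass $c_0=\frac{\sum_k m_kx_k}{\sum_k m_k}$. Then $(x_1,x_2,x_3)$ is a central configuration for the masses $(m_1,m_2,m_3)$ and the potential $U_\alpha$ if and only if $m_1=m_2=m_3$ and $x_1,x_2,x_3$ are the vertices of an equilateral triangle.
   Context: For $\alpha>0$, masses $m_1,\dots,m_n>0$ and pairwise distinct points $x_1,\dots,x_n\in\mathbb{R}^3$, the power-law potential is $U_\alpha(x)=\sum_{1\le j<k\le n}\frac{m_jm_k}{|x_j-x_k|^\alpha}$. The configuration $(x_1,\dots,x_n)$ is a central configuration for the masses $(m_1,\dots,m_n)$ if there is a constant $\lambda\in\mathbb{R}$ such that $$\sum_{j\ne k}\frac{x_j-x_k}{|x_j-x_k|^{\alpha+2}}m_jm_k=-\frac{\lambda}{\alpha}m_k(x_k-c_0),\qquad k=1,\dots,n,$$ where $c_0=\frac{\sum_{k}m_kx_k}{\sum_k m_k}$ is the center of mass. A central configuration is centered co-circular if all the points lie on a circle (of positive radius, in a plane) whose center is $c_0$. Central configurations are considered modulo rotations, translations and dilations. *)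

(* Defs.v *)
From mathcomp Require Import all_boot all_order all_algebra.
From mathcomp Require Import all_classical all_reals all_analysis.

Set Implicit Arguments.
Unset Strict Implicit.
Unset Printing Implicit Defensive.

Import Order.TTheory GRing.Theory Num.Theory.

Local Open Scope ring_scope.

(* The norm that MathComp-Analysis puts on 'rV[R]_d is the sup norm, so the
   Euclidean norm is defined here. *)
Definition enorm (R : realType) (d : nat) (u : 'rV[R]_d) : R :=
  Num.sqrt (\sum_(i < d) u 0 i ^+ 2).

Definition center_of_mass (R : realType) (n : nat)
    (m : 'I_n -> R) (x : 'I_n -> 'rV[R]_3) : 'rV[R]_3 :=
  (\sum_k m k)^-1 *: \sum_k m k *: x k.

(* The equations for the power-law potential
   \sum_(j < k) m_j m_k / |x_j - x_k|^alpha; they are meaningful for pairwise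
   distinct points only, which is assumed separately wherever this is used. *)
Definition central_configuration (R : realType) (n : nat) (alpha : R)
    (m : 'I_n -> R) (x : 'I_n -> 'rV[R]_3) : Prop :=
  exists lambda : R, forall k : 'I_n,
    \sum_(j < n | j != k)
      (m j * m k / enorm (x j - x k) `^ (alpha + 2)) *: (x j - x k)
    = - (lambda / alpha * m k) *: (x k - center_of_mass m x).

(* The circle of center c and radius r in the affine plane c + W, where the
   direction W is the row space of a rank 2 matrix. *)
Definition on_circle (R : realType) (c : 'rV[R]_3) (r : R) (W : 'M[R]_3)
    (p : 'rV[R]_3) : Prop :=
  (p - c <= W)%MS /\ enorm (p - c) = r.

Definition centered_cocircular (R : realType) (n : nat)
    (m : 'I_n -> R) (x : 'I_n -> 'rV[R]_3) : Prop :=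
  exists (r : R) (W : 'M[R]_3),
    [/\ 0 < r, \rank W = 2%N
      & forall k : 'I_n, on_circle (center_of_mass m x) r W (x k)].

(* All sides have the same length; nondegenerate when x is injective. *)
Definition equilateral_triangle (R : realType) (x : 'I_3 -> 'rV[R]_3) : Prop :=
  forall i j k l : 'I_3, i != j -> k != l ->
    enorm (x i - x j) = enorm (x k - x l).

(* Main.v *)
Require Import Defs.
From mathcomp Require Import all_boot all_order all_algebra.
From mathcomp Require Import all_classical all_reals all_analysis.
From mathcomp Require Import ring lra zify.

Import Order.TTheory GRing.Theory Num.Theory.

Local Open Scope ring_scope.

(** Let [y_k = x_k - c0], so that [\sum_k m_k y_k = 0] and all [y_k] have the
    same positive norm.  Writing [s_ij = 1 / |x_i - x_j|^(alpha+2)] and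
    subtracting [s_ik * \sum_l m_l y_l = 0] from the [i]-th equation leaves
    [m_j (s_ij - s_ik) y_j] proportional to [y_i].  If [s_ij != s_ik], then
    [y_j = - y_i], so [y_k] is proportional to [y_i] too and coincides with
    [y_i] or [y_j], a contradiction.  Hence the triangle is equilateral, all
    products [y_i . y_j] with [i != j] coincide, and pairing
    [\sum_k m_k y_k = 0] with each [y_i] shows that the masses are equal. *)

Section EuclideanNorm.
Variables (R : realType) (d : nat).
Implicit Types u v : 'rV[R]_d.

Definition edot u v : R := \sum_(i < d) u 0 i * v 0 i.

Lemma sqr_enorm u : enorm u ^+ 2 = edot u u.
Proof.
rewrite /enorm sqr_sqrtr; last by apply: sumr_ge0 => i _; exact: sqr_ge0.
by apply: eq_bigr => i _; rewrite expr2.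
Qed.

Lemma enorm_ge0 u : 0 <= enorm u.
Proof. exact: sqrtr_ge0. Qed.

Lemma enorm_eq0 u : enorm u = 0 -> u = 0.
Proof.
move=> u0; have : edot u u = 0 by rewrite -sqr_enorm u0 expr0n.
rewrite /edot => /eqP; rewrite psumr_eq0; last first.
  by move=> i _; rewrite -expr2 sqr_ge0.
move=> /allP h; apply/rowP => i; rewrite mxE.
by have := h i (mem_index_enum _); rewrite /= mulf_eq0 orbb => /eqP.
Qed.

Lemma enormZ a u : enorm (a *: u) = `|a| * enorm u.
Proof.
rewrite /enorm -sqrtr_sqr -sqrtrM ?sqr_ge0// mulr_sumr; congr Num.sqrt.
by apply: eq_bigr => i _; rewrite mxE exprMn.
Qed.

Lemma enorm_gt0B u v : u <> v -> 0 < enorm (u - v).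
Proof.
move=> uv; rewrite lt_neqAle enorm_ge0 andbT eq_sym; apply/eqP => /enorm_eq0.
by move/eqP; rewrite subr_eq0 => /eqP.
Qed.

Lemma enormBC u v : enorm (u - v) = enorm (v - u).
Proof. by rewrite -opprB -scaleN1r enormZ normrN normr1 mul1r. Qed.

Lemma edotDr w u v : edot w (u + v) = edot w u + edot w v.
Proof.
by rewrite /edot -big_split; apply: eq_bigr => i _; rewrite mxE mulrDr.
Qed.

Lemma edotZr w a u : edot w (a *: u) = a * edot w u.
Proof.
by rewrite /edot mulr_sumr; apply: eq_bigr => i _; rewrite mxE mulrCA.
Qed.

Lemma sqr_enormB u v :
  enorm (u - v) ^+ 2 = enorm u ^+ 2 + enorm v ^+ 2 - 2 * edot u v.
Proof.
rewrite !sqr_enorm /edot mulr_sumr -!big_split /= -sumrB.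
by apply: eq_bigr => i _; rewrite !mxE; ring.
Qed.

(** Comparing norms forces the ratio [a^-1 * b] to have absolute value 1. *)
Lemma collinear_same_enorm a b u v : 0 < enorm u -> enorm v = enorm u ->
  a != 0 -> a *: v = b *: u -> v = u \/ v = - u.
Proof.
move=> u0 vu a0 e.
have ve : v = (a^-1 * b) *: u.
  by rewrite -scalerA -e scalerA mulVf// scale1r.
move: vu; rewrite ve enormZ => /(canRL (mulfK (lt0r_neq0 u0))).
rewrite divff ?lt0r_neq0// => /eqP; rewrite eqr_norml ler01 andbT.
by case/orP => /eqP ->; [left|right]; rewrite ?scale1r ?scaleN1r.
Qed.

End EuclideanNorm.

Arguments edot {R d}.

Lemma sum_center_of_mass (R : realType) (n : nat) (m : 'I_n -> R)
    (x : 'I_n -> 'rV[R]_3) : \sum_k m k != 0 ->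
  \sum_k m k *: (x k - center_of_mass m x) = 0.
Proof.
move=> M0; under eq_bigr do rewrite scalerBr.
rewrite sumrB -scaler_suml /center_of_mass scalerA divff// scale1r.
exact: subrr.
Qed.

Lemma big_neq3 (V : nmodType) (F : 'I_3 -> V) (i j k : 'I_3) :
  i != j -> i != k -> j != k -> \sum_(l < 3 | l != i) F l = F j + F k.
Proof.
move=> ij ik jk; rewrite (bigD1 j) ?[j == i]eq_sym//= (bigD1 k)/=; last first.
  by rewrite ![k == _]eq_sym ik jk.
rewrite big_pred0 ?addr0// => l; apply/negbTE; move: ij ik jk.
rewrite -!val_eqE /=.
by have := ltn_ord i; have := ltn_ord j; have := ltn_ord k;
  have := ltn_ord l; lia.
Qed.

Lemma big_ord3 (V : nmodType) (F : 'I_3 -> V) (i j k : 'I_3) :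
  i != j -> i != k -> j != k -> \sum_(l < 3) F l = F i + F j + F k.
Proof.
by move=> ij ik jk; rewrite (bigD1 i)//= (big_neq3 _ _ _ j k)// addrA.
Qed.

Lemma third_index (i j : 'I_3) : i != j -> exists k, i != k /\ j != k.
Proof.
rewrite -val_eqE /= => ij.
(* The indices 0, 1, 2 add up to 3, which determines the missing one. *)
have hk : (3 - i - j < 3)%N by have := ltn_ord i; have := ltn_ord j; lia.
exists (Ordinal hk); rewrite -!val_eqE /=.
by have := ltn_ord i; have := ltn_ord j; lia.
Qed.

Lemma equal_enorm_coeffs (R : realType) (d : nat) (u v w : 'rV[R]_d)
    (a b c s t e : R) :
  0 < enorm u -> enorm v = enorm u -> enorm w = enorm u ->
  v <> u -> w <> u -> w <> v -> 0 < b -> 0 < c ->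
  a *: u + b *: v + c *: w = 0 ->
  (b * s) *: v + (c * t) *: w = e *: u -> s = t.
Proof.
move=> u0 vu wu nvu nwu nwv b0 c0 com E; apply/eqP/negPn/negP => st.
(* Subtracting [t] times the relation [com] eliminates [w]. *)
have hv : (b * (s - t)) *: v = (e + t * a) *: u.
  rewrite scalerDl -E; apply/eqP; rewrite -subr_eq0.
  have -> : 0 = - t *: (a *: u + b *: v + c *: w) by rewrite com scaler0.
  by apply/eqP/rowP => i; rewrite !mxE; ring.
have bst : b * (s - t) != 0 by rewrite mulf_neq0 ?subr_eq0 ?lt0r_neq0.
have [//|vNu] := collinear_same_enorm _ _ _ _ _ _ u0 vu bst hv.
(* Once [v = - u], the relation [com] makes [w] a multiple of [u] as well, leaving no third place
   for it among [u] and [- u]. *)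
have hw : c *: w = (b - a) *: u.
  apply/eqP; rewrite -subr_eq0 -com vNu; apply/eqP/rowP => i.
  by rewrite !mxE; ring.
have [//|wNu] := collinear_same_enorm _ _ _ _ _ _ u0 wu (lt0r_neq0 c0) hw.
by apply: nwv; rewrite wNu vNu.
Qed.

Section CocircularTriangle.
Variables (R : realType) (alpha : R) (m : 'I_3 -> R) (x : 'I_3 -> 'rV[R]_3).
Hypotheses (alpha_gt0 : 0 < alpha) (m_gt0 : forall k, 0 < m k).
Hypothesis x_distinct : injective x.

Let c0 := center_of_mass m x.
Let y k : 'rV[R]_3 := x k - c0.

Let xBE i j : x i - x j = y i - y j.
Proof. by rewrite /y opprB addrA subrK. Qed.

Let com3 i j k : i != j -> i != k -> j != k ->
  m i *: y i + m j *: y j + m k *: y k = 0.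
Proof.
move=> ij ik jk; rewrite -(big_ord3 _ (fun l => m l *: y l))//.
apply: sum_center_of_mass; rewrite (big_ord3 _ _ i j k)//.
by rewrite lt0r_neq0// !addr_gt0.
Qed.

Lemma central_configuration_sides i j k : centered_cocircular m x ->
  central_configuration alpha m x -> i != j -> i != k -> j != k ->
  enorm (x j - x i) = enorm (x k - x i).
Proof.
move=> [r [W [r0 _ onW]]] [lambda cc] ij ik jk.
have yr l : enorm (y l) = r by have [] := onW l.
have dist a b : a != b -> y b <> y a.
  by move=> + /addIr /x_distinct e; rewrite e eqxx.
pose s a := (enorm (x a - x i) `^ (alpha + 2))^-1.
(* This is the equation at vertex [i], divided by [m i], with all multiples of [y i] moved to the
   right. *)
have E : (m j * s j) *: y j + (m k * s k) *: y k =
    (m j * s j + m k * s k - lambda / alpha) *: y i.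
  have := cc i; rewrite (big_neq3 _ _ _ j k)// -/c0 -/(y i) => /eqP.
  rewrite -subr_eq0 => /eqP e; apply: (@scalerI _ _ (m i)).
    exact: lt0r_neq0.
  apply/eqP; rewrite -subr_eq0 -e /s !xBE; move: (y i) (y j) (y k) => u v w.
  move: (_ `^ _) (_ `^ _) => p q.
  by apply/eqP/rowP => l; rewrite !mxE; ring.
have sE : s j = s k.
  by apply: equal_enorm_coeffs (com3 _ _ _ ij ik jk) E; rewrite ?yr//;
    exact: dist.
have a2 : 0 < alpha + 2 by exact: addr_gt0.
apply: (powR_injective a2); rewrite ?nnegrE ?enorm_ge0//.
exact: invr_inj.
Qed.

Lemma equilateral_masses i j : centered_cocircular m x ->
  equilateral_triangle x -> m i = m j.
Proof.
move=> [r [W [r0 _ onW]]] eqx; have [->//|ij] := eqVneq i j.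
have [k [ik jk]] := third_index _ _ ij.
have yr l : enorm (y l) = r by have [] := onW l.
(* By the law of cosines, equal sides and equal radii give all products of distinct [y a], [y b] a
   common value [p]. *)
have D a b : a != b ->
    enorm (x i - x j) ^+ 2 = r ^+ 2 + r ^+ 2 - 2 * edot (y a) (y b).
  by move=> ab; rewrite (eqx _ _ _ _ ij ab) xBE sqr_enormB !yr.
have D0 : 0 < enorm (x i - x j) ^+ 2.
  by rewrite exprn_gt0// enorm_gt0B// => /x_distinct e; rewrite e eqxx in ij.
have dotc w : m i * edot w (y i) + m j * edot w (y j) + m k * edot w (y k) = 0.
  rewrite -!edotZr -!edotDr com3//.
  by rewrite /edot big1// => l _; rewrite mxE mulr0.
have := dotc (y i); have := dotc (y j); rewrite -!sqr_enorm !yr.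
have ji : j != i by rewrite eq_sym.
have := D _ _ ij; have := D _ _ ji; have := D _ _ ik; have := D _ _ jk.
set d2 := enorm _ ^+ 2 in D0 *.
move=> Djk Dik Dji Dij ej ei.
(* Pairing with [y i] and with [y j] gives [m i * r^2 + (m j + m k) * p = 0] and the same with [i]
   and [j] exchanged. The difference is [(m i - m j) * (r^2 - p) = 0], where [r^2 - p = d2 / 2]. *)
have : (m i - m j) * d2 = 0.
  have bE a : d2 = r ^+ 2 + r ^+ 2 - 2 * a -> a = r ^+ 2 - d2 / 2 by lra.
  move: ej ei; rewrite (bE _ Djk) (bE _ Dik) (bE _ Dji) (bE _ Dij); lra.
by move/eqP; rewrite mulf_eq0 (gt_eqF D0) orbF subr_eq0 => /eqP.
Qed.

Lemma equilateral_central_configuration :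
  (forall i j, m i = m j) -> equilateral_triangle x ->
  central_configuration alpha m x.
Proof.
move=> eqm eqx.
pose s := (enorm (x 0 - x 1) `^ (alpha + 2))^-1.
(* Since [y j + y k = - y i], the left side is [m 0 ^ 2 * s] times [y j + y k - 2 y i = - 3 y i];
   comparing with [- (lambda / alpha * m 0)] times [y i] gives [lambda]. *)
exists (3 * alpha * m 0 * s) => i.
have [j ij] : exists j, i != j.
  by have [->|i0] := eqVneq i 0; [exists 1|exists 0].
have [k [ik jk]] := third_index _ _ ij.
have ji : j != i by rewrite eq_sym.
have ki : k != i by rewrite eq_sym.
have xE a : a != i -> enorm (x a - x i) = enorm (x 0 - x 1).
  by move=> ai; apply: eqx.
rewrite (big_neq3 _ _ _ j k)// !xE// -/s !xBE -/c0 -/(y i).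
rewrite (eqm i 0) (eqm j 0) (eqm k 0).
have com := com3 i j k ij ik jk.
rewrite (eqm i 0) (eqm j 0) (eqm k 0) in com.
apply/eqP; rewrite -subr_eq0; apply/eqP.
(* The difference of the two sides is exactly [m 0 * s] times the center of mass relation. *)
rewrite -[RHS](scaler0 _ (m 0 * s)) -com.
have a0 := lt0r_neq0 alpha_gt0; move: s (y i) (y j) (y k) => s u v w.
by apply/rowP => l; rewrite !mxE; field.
Qed.

End CocircularTriangle.

Theorem corollary3p5 (R : realType) (alpha : R) (m : 'I_3 -> R)
    (x : 'I_3 -> 'rV[R]_3)
    (alpha_gt0 : 0 < alpha)
    (m_gt0 : forall k : 'I_3, 0 < m k)
    (x_distinct : injective x)
    (x_cocircular : centered_cocircular m x) :
  central_configuration alpha m x <->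
  (forall i j : 'I_3, m i = m j) /\ equilateral_triangle x.
Proof.
split=> [cc|[eqm eqx]]; last exact: equilateral_central_configuration.
have side i j k : i != j -> i != k -> enorm (x i - x j) = enorm (x i - x k).
  move=> ij ik; have [->//|jk] := eqVneq j k.
  rewrite enormBC [RHS]enormBC.
  exact: (@central_configuration_sides _ alpha m).
have eqx : equilateral_triangle x.
  (* Sides with a common vertex are equal by [side]; otherwise [ij] is compared with [kl] through
     the side [ik], which meets both. *)
  move=> i j k l ij kl; have [ik|ik] := eqVneq i k.
    by rewrite -ik in kl *; exact: side.
  have ki : k != i by rewrite eq_sym.
  by rewrite (side i j k)// enormBC; exact: side.
by split=> // i j; exact: (@equilateral_masses _ m x).
Qed.
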